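(* Let $G$ be a graph with graph Laplacian $\mathbf{L}$ and normalized graph Laplacian $\tilde{\mathbf{L}}$. If for a node-level positional encoding $\mathbf{Q}\in\mathbb{R}^{n\times d'}$ with compact domain there exist matrices $\mathbf{W}^Q,\mathbf{W}^K$ such that $$\frac{1}{\sqrt{d_k}}(\mathbf{Q}\mathbf{W}^Q)(\mathbf{Q}\mathbf{W}^K)^T=\tilde{\mathbf{L}},$$ then there exists a parameterization of the structural embeddings $\mathbf{P}$ with $\mathbf{Q}$ as node-level positional encoding such that $\mathbf{P}$ is sufficiently node- and adjacency-identifying.
   Context: Graphs are finite, undirected, without self-loops and without isolated nodes, with $n$ nodes, adjacency matrix $\mathbf{A}(G)$, degree matrix $\mathbf{D}$; $\mathbf{L}=\mathbf{D}-\mathbf{A}(G)$, $\tilde{\mathbf{L}}=\mathbf{I}-\mathbf{D}^{-1/2}\mathbf{A}(G)\mathbf{D}^{-1/2}$; $d_k>0$ is fixed. Structural embeddings with node-level positional encoding $\mathbf{Q}$: $\mathbf{P}(v)=\mathsf{FFN}(\mathrm{emb}_{\deg}(v)+\mathbf{Q}(v))$, where $\mathrm{emb}_{\deg}$ is a learnable embedding of the degree of $v$ and $\mathsf{FFN}$ an MLP (both parametrized; the embedding dimension is also a parameter). With $\tilde{\mathbf{P}}=\frac{1}{\sqrt{d_k}}\mathbf{P}\mathbf{W}^Q(\mathbf{P}\mathbf{W}^K)^T$: $\mathbf{P}$ is node-identifying if for some $\mathbf{W}^Q,\mathbf{W}^K$: $\tilde{\mathbf{P}}_{ij}=\max_k\tilde{\mathbf{P}}_{ik}\iff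 i=j$; adjacency-identifying if for some $\mathbf{W}^Q,\mathbf{W}^K$: $\tilde{\mathbf{P}}_{ij}=\max_k\tilde{\mathbf{P}}_{ik}\iff\mathbf{A}(G)_{ij}=1$. Parametrized structural embeddings are sufficiently node-identifying (resp. adjacency-identifying) if there is a node-identifying (resp. adjacency-identifying) matrix $\mathbf{P}^*$ such that for every $\varepsilon>0$ some parameter choice yields embeddings within Frobenius distance $\varepsilon$ of $\mathbf{P}^*$. *)

(* Defs.v *)
From HB Require Import structures.
From mathcomp Require Import all_boot all_order all_algebra.
From mathcomp Require Import reals.
Set Implicit Arguments. Unset Strict Implicit. Unset Printing Implicit Defensive.
Import Order.TTheory GRing.Theory Num.Theory.
Local Open Scope ring_scope.

Section Defs.
Variable R : realType.

Definition simple_graph_no_isolated (n : nat) (adj : rel 'I_n) : Prop :=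
  [/\ symmetric adj, irreflexive adj & forall i : 'I_n, exists j, adj i j].

Definition adjmx (n : nat) (adj : rel 'I_n) : 'M[R]_n :=
  \matrix_(i, j) (adj i j)%:R.

Definition degree (n : nat) (adj : rel 'I_n) (i : 'I_n) : nat :=
  #|[set j | adj i j]|.

Definition degmx (n : nat) (adj : rel 'I_n) : 'M[R]_n :=
  diag_mx (\row_i (degree adj i)%:R).

Definition degmx_invsqrt (n : nat) (adj : rel 'I_n) : 'M[R]_n :=
  diag_mx (\row_i (Num.sqrt (degree adj i)%:R)^-1).

Definition laplacian (n : nat) (adj : rel 'I_n) : 'M[R]_n :=
  degmx adj - adjmx adj.

Definition norm_laplacian (n : nat) (adj : rel 'I_n) : 'M[R]_n :=
  1%:M - degmx_invsqrt adj *m adjmx adj *m degmx_invsqrt adj.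

Definition attn_scores (dk n d : nat) (P : 'M[R]_(n, d))
  (WQ WK : 'M[R]_(d, dk)) : 'M[R]_n :=
  (Num.sqrt (dk%:R))^-1 *: ((P *m WQ) *m (P *m WK)^T).

Definition row_argmax (n : nat) (M : 'M[R]_n) (i j : 'I_n) : Prop :=
  forall k : 'I_n, M i k <= M i j.

Definition node_identifying (dk n d : nat) (P : 'M[R]_(n, d)) : Prop :=
  exists WQ WK : 'M[R]_(d, dk),
    forall i j : 'I_n, row_argmax (attn_scores P WQ WK) i j <-> i = j.

Definition adjacency_identifying (dk n d : nat) (adj : rel 'I_n)
  (P : 'M[R]_(n, d)) : Prop :=
  exists WQ WK : 'M[R]_(d, dk),
    forall i j : 'I_n,
      row_argmax (attn_scores P WQ WK) i j <-> adjmx adj i j = 1.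

Definition frobenius (m n : nat) (M : 'M[R]_(m, n)) : R :=
  Num.sqrt (\sum_i \sum_j M i j ^+ 2).

Inductive mlp : nat -> nat -> Type :=
| mlp_out (din dout : nat) of 'M[R]_(din, dout) & 'rV[R]_dout : mlp din dout
| mlp_hidden (din h dout : nat) of 'M[R]_(din, h) & 'rV[R]_h & mlp h dout
    : mlp din dout.

Definition relu_vec (k : nat) (x : 'rV[R]_k) : 'rV[R]_k :=
  map_mx (fun a => Num.max a 0) x.

Fixpoint mlp_eval (din dout : nat) (f : mlp din dout) : 'rV[R]_din -> 'rV[R]_dout :=
  match f in mlp a b return 'rV[R]_a -> 'rV[R]_b with
  | mlp_out _ _ W b => fun x => x *m W + b
  | mlp_hidden _ _ _ W b g => fun x => mlp_eval g (relu_vec (x *m W + b))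
  end.

(* P(v) = FFN(emb_deg(deg v) + Q(v)); the degree embedding is a learnable
   lookup table nat -> R^{d'}, the FFN is a ReLU MLP R^{d'} -> R^d. *)
Definition struct_emb (n d' d : nat) (adj : rel 'I_n) (Q : 'M[R]_(n, d'))
  (emb : nat -> 'rV[R]_d') (ffn : mlp d' d) : 'M[R]_(n, d) :=
  \matrix_(v < n) mlp_eval ffn (emb (degree adj v) + row v Q).

Definition suff_node_identifying (dk n d' d : nat) (adj : rel 'I_n)
  (Q : 'M[R]_(n, d')) : Prop :=
  exists Pstar : 'M[R]_(n, d), node_identifying dk Pstar /\
    forall eps : R, 0 < eps ->
      exists (emb : nat -> 'rV[R]_d') (ffn : mlp d' d),
        frobenius (struct_emb adj Q emb ffn - Pstar) < eps.

Definition suff_adjacency_identifying (dk n d' d : nat) (adj : rel 'I_n)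
  (Q : 'M[R]_(n, d')) : Prop :=
  exists Pstar : 'M[R]_(n, d), adjacency_identifying dk adj Pstar /\
    forall eps : R, 0 < eps ->
      exists (emb : nat -> 'rV[R]_d') (ffn : mlp d' d),
        frobenius (struct_emb adj Q emb ffn - Pstar) < eps.

End Defs.

(* Main.v *)
(** The identity [Q W1 = L~] makes a single ReLU layer decode [Q] into the
    one-hot node indicators: the diagonal of [L~] is 1 and its off-diagonal
    entries are [<= 0].  A linear output layer then writes down any target
    embedding exactly, so it suffices to exhibit one [P] that is both node-
    and adjacency-identifying.  Take [P = [Q WQ | D^(1/2) Q WK]]: its attention
    scores are [± L~ D^(1/2)], whose row [i] is [sqrt d_i] on the diagonal and
    [- 1 / sqrt d_i] on the neighbours of [i].  With sign [+] the row maximum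
    sits exactly on the diagonal; with sign [-] exactly on the neighbours. *)
Require Import Defs.
From HB Require Import structures.
From mathcomp Require Import all_boot all_order all_algebra.
From mathcomp Require Import reals.
Set Implicit Arguments. Unset Strict Implicit. Unset Printing Implicit Defensive.
Import Order.TTheory GRing.Theory Num.Theory.
Local Open Scope ring_scope.

Section RowArgmax.
Variables (R : realType) (n : nat).

Lemma row_argmax_diag (M : 'M[R]_n) :
  (forall i, 0 < M i i) -> (forall i j, i != j -> M i j <= 0) ->
  forall i j, row_argmax M i j <-> i = j.
Proof.
move=> Mdiag Moff i j; split => [Mij_max | <- k].
  apply/eqP; apply: contraLR (Mij_max i) => /Moff Mij_le0.
  by rewrite -ltNge (le_lt_trans Mij_le0).
have [<- // | /Moff Mik_le0] := eqVneq i k.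
exact: le_trans Mik_le0 (ltW (Mdiag i)).
Qed.

Lemma row_argmax_adj (adj : rel 'I_n) (a : 'I_n -> R) (M : 'M[R]_n) :
  irreflexive adj -> (forall i, exists j, adj i j) -> (forall i, 0 < a i) ->
  (forall i, M i i < 0) -> (forall i j, i != j -> M i j = a i * (adj i j)%:R) ->
  forall i j, row_argmax M i j <-> adj i j.
Proof.
move=> adj_irr adj_total a_gt0 Mdiag Moff i j.
have Mneighbour k : adj i k -> M i k = a i.
  move=> adj_ik; rewrite Moff ?adj_ik ?mulr1 //.
  by apply: contraTneq adj_ik => <-; rewrite adj_irr.
split => [Mij_max | adj_ij k].
  have [k adj_ik] := adj_total i; have := Mij_max k; rewrite Mneighbour //.
  have [<- | /Moff ->] := eqVneq i j.
    by move/(lt_le_trans (a_gt0 i)); rewrite ltNge ltW.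
  by case: (adj i j); rewrite ?mulr0 // => /(lt_le_trans (a_gt0 i)); rewrite ltxx.
rewrite [M i j]Mneighbour //; have [<- | /Moff ->] := eqVneq i k.
  exact: ltW (lt_trans (Mdiag i) (a_gt0 i)).
by case: (adj i k); rewrite ?mulr1 ?mulr0 ?(ltW (a_gt0 i)).
Qed.

End RowArgmax.

Lemma adjmx_eq1 (R : realType) (n : nat) (adj : rel 'I_n) (i j : 'I_n) :
  adjmx R adj i j = 1 <-> adj i j.
Proof. by rewrite mxE; case: (adj i j); split => // /eqP; rewrite eq_sym oner_eq0. Qed.

Section Embeddings.
Variables (R : realType) (n d' d : nat) (adj : rel 'I_n) (Q : 'M[R]_(n, d')).

Lemma struct_emb_one_hot (W : 'M[R]_(d', n)) (P : 'M[R]_(n, d)) :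
  map_mx (fun a => Num.max a 0) (Q *m W) = 1%:M ->
  struct_emb adj Q (fun _ => 0) (mlp_hidden W 0 (mlp_out P 0)) = P.
Proof.
move=> reluQW; apply/row_matrixP => v; rewrite rowK /= add0r !addr0.
by rewrite /relu_vec -row_mul map_row reluQW row1 rowE.
Qed.

Lemma frobenius0 : frobenius (0 : 'M[R]_(n, d)) = 0.
Proof.
rewrite /frobenius big1 ?sqrtr0 // => i _.
by rewrite big1 // => j _; rewrite mxE expr0n.
Qed.

Lemma approx_of_struct_emb (P : 'M[R]_(n, d)) :
  (exists emb ffn, struct_emb adj Q emb ffn = P) ->
  forall eps : R, 0 < eps ->
    exists emb ffn, frobenius (struct_emb adj Q emb ffn - P) < eps.
Proof. by move=> [emb [ffn <-]] eps eps_gt0; exists emb, ffn; rewrite subrr frobenius0. Qed.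

End Embeddings.

Lemma attn_scores_row_mx (R : realType) (dk n : nat) (A B : 'M[R]_(n, dk)) (s : R) :
  attn_scores (row_mx A B) (s *: col_mx 1%:M 0) (col_mx 0 1%:M)
  = (s / Num.sqrt dk%:R) *: (A *m B^T).
Proof.
rewrite /attn_scores -scalemxAr !mul_row_col !mulmx0 !mulmx1 addr0 add0r.
by rewrite -scalemxAl scalerA mulrC.
Qed.

Definition degmx_sqrt (R : realType) (n : nat) (adj : rel 'I_n) : 'M[R]_n :=
  diag_mx (\row_i Num.sqrt (degree adj i)%:R).

Section NormLaplacian.
Variables (R : realType) (n : nat) (adj : rel 'I_n).
Hypothesis adj_simple : simple_graph_no_isolated adj.

Let sqdeg (i : 'I_n) : R := Num.sqrt (degree adj i)%:R.

Lemma sqrt_degree_gt0 i : 0 < sqdeg i.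
Proof.
case: adj_simple => _ _ /(_ i) [j adj_ij].
rewrite sqrtr_gt0 ltr0n card_gt0; by apply/set0Pn; exists j; rewrite inE.
Qed.

Lemma norm_laplacianE i j :
  norm_laplacian R adj i j = (i == j)%:R - (adj i j)%:R / (sqdeg i * sqdeg j).
Proof.
rewrite /norm_laplacian /degmx_invsqrt mxE mul_mx_diag mul_diag_mx !mxE.
by rewrite invfM mulrCA mulrA.
Qed.

Lemma norm_laplacian_diag i : norm_laplacian R adj i i = 1.
Proof. by case: adj_simple => _ adj_irr _; rewrite norm_laplacianE eqxx adj_irr mul0r subr0. Qed.

Lemma norm_laplacian_offdiag i j :
  i != j -> norm_laplacian R adj i j = - ((adj i j)%:R / (sqdeg i * sqdeg j)).
Proof. by move/negbTE; rewrite norm_laplacianE => ->; rewrite sub0r. Qed.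

Lemma relu_norm_laplacian :
  map_mx (fun a => Num.max a 0) (norm_laplacian R adj) = 1%:M.
Proof.
apply/matrixP => i j; rewrite [LHS]mxE [RHS]mxE; have [<- | i_neq_j] := eqVneq i j.
  by rewrite norm_laplacian_diag; apply/max_idPl; rewrite ler01.
apply/max_idPr; rewrite norm_laplacian_offdiag // oppr_le0 divr_ge0 //.
by rewrite mulr_ge0 ?sqrtr_ge0.
Qed.

Lemma norm_laplacian_degmx_sqrtE i j :
  (norm_laplacian R adj *m degmx_sqrt R adj) i j =
  if i == j then sqdeg i else - ((adj i j)%:R / sqdeg i).
Proof.
rewrite mul_mx_diag mxE [X in _ * X]mxE; have [<- | i_neq_j] := eqVneq i j.
  by rewrite norm_laplacian_diag mul1r.
rewrite norm_laplacian_offdiag // invfM mulrA mulNr divfK //.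
by rewrite gt_eqF ?sqrt_degree_gt0.
Qed.

Lemma row_argmax_norm_laplacian_degmx_sqrt i j :
  row_argmax (norm_laplacian R adj *m degmx_sqrt R adj) i j <-> i = j.
Proof.
apply: row_argmax_diag => {i j} [i | i j i_neq_j]; rewrite norm_laplacian_degmx_sqrtE.
  by rewrite eqxx sqrt_degree_gt0.
by rewrite (negbTE i_neq_j) oppr_le0 divr_ge0 ?sqrtr_ge0.
Qed.

Lemma row_argmax_opp_norm_laplacian_degmx_sqrt i j :
  row_argmax (- (norm_laplacian R adj *m degmx_sqrt R adj)) i j <-> adj i j.
Proof.
have [_ adj_irr adj_total] := adj_simple.
apply: (row_argmax_adj (a := fun i => (sqdeg i)^-1)) => // {i j} [i | i | i j i_neq_j].
- by rewrite invr_gt0 sqrt_degree_gt0.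
- by rewrite mxE norm_laplacian_degmx_sqrtE eqxx oppr_lt0 sqrt_degree_gt0.
by rewrite mxE norm_laplacian_degmx_sqrtE (negbTE i_neq_j) opprK mulrC.
Qed.

End NormLaplacian.

Theorem lemmaF13 (R : realType) (dk : nat) (n : nat) (adj : rel 'I_n)
  (d' : nat) (Q : 'M[R]_(n, d')) :
  (0 < dk)%N ->
  simple_graph_no_isolated adj ->
  (exists WQ WK : 'M[R]_(d', dk), attn_scores Q WQ WK = norm_laplacian R adj) ->
  exists d : nat,
    suff_node_identifying dk d adj Q /\ suff_adjacency_identifying dk d adj Q.
Proof.
move=> _ adj_simple [WQ [WK QQ_eq]].
pose P := row_mx (Q *m WQ) (degmx_sqrt R adj *m (Q *m WK)).
have scoresE s : attn_scores P (s *: col_mx 1%:M 0) (col_mx 0 1%:M)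
    = s *: (norm_laplacian R adj *m degmx_sqrt R adj).
  rewrite attn_scores_row_mx -QQ_eq /attn_scores trmx_mul tr_diag_mx.
  by rewrite -scalemxAl scalerA !mulmxA.
have P_realized : exists emb ffn, struct_emb adj Q emb ffn = P.
  exists (fun _ => 0), (mlp_hidden ((Num.sqrt dk%:R)^-1 *: (WQ *m (Q *m WK)^T))
                                   0 (mlp_out P 0)).
  apply: struct_emb_one_hot.
  by rewrite -scalemxAr mulmxA -/(attn_scores Q WQ WK) QQ_eq relu_norm_laplacian.
exists (dk + dk)%N; split; exists P; (split; last exact: approx_of_struct_emb P_realized).
- exists (1 *: col_mx 1%:M 0), (col_mx 0 1%:M) => i j.
  by rewrite scoresE scale1r row_argmax_norm_laplacian_degmx_sqrt.
- exists ((-1) *: col_mx 1%:M 0), (col_mx 0 1%:M) => i j.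
  by rewrite scoresE scaleN1r adjmx_eq1 row_argmax_opp_norm_laplacian_degmx_sqrt.
Qed.
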